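(* Let $d\ge 1$ be an integer. The family of graphs with VC-dimension $d$ has the $B_2$ property if and only if $d=1$.
   Context: All graphs are finite and simple. Given a set system $\mathcal{F}\subseteq 2^X$, a set $S\subseteq X$ is shattered by $\mathcal{F}$ if for every $B\subseteq S$ there exists $F\in\mathcal{F}$ with $F\cap S=B$. The VC-dimension of $\mathcal{F}$ is the size of the largest set shattered by $\mathcal{F}$. The VC-dimension of a graph $G$ is the VC-dimension of the set system $\{N_G(v):v\in V(G)\}\subseteq 2^{V(G)}$, where $N_G(v)$ is the set of neighbours of $v$ (so $v\notin N_G(v)$). $\varrho_2(G)$ is the number of edges of $G$ divided by $\binom{|V(G)|}{2}$. $K_2[t]=K_{t,t}$; for non-integer $t$ read $\lfloor t\rfloor$. A graph class $\mathcal{G}$ has the $B_2$ property if there is a function $f:\mathbb{R}^+\to\mathbb{R}^+$ such that for any $\varepsilon>0$ and any $n$-vertex $G\in\mathcal{G}$ with $\varrho_2(G)>\varepsilon$, $G$ contains a $K_2[f(\varepsilon)n]$ as a not necessarily induced subgraph. *)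

(* Defs.v *)
From HB Require Import structures.
From mathcomp Require Import all_boot all_order all_algebra.
From mathcomp Require Import reals.

Set Implicit Arguments.
Unset Strict Implicit.
Unset Printing Implicit Defensive.

Import Order.TTheory GRing.Theory Num.Theory.
Local Open Scope ring_scope.

Record graph := Graph {
  vertex :> finType;
  adj : rel vertex;
  adj_sym : symmetric adj;
  adj_irr : irreflexive adj }.

Definition neighbours (G : graph) (v : G) : {set G} := [set w | adj v w].

Definition edges (G : graph) : {set {set G}} :=
  [set [set p.1; p.2] | p : G * G & adj p.1 p.2].

(* When #|G| < 2 the denominator is 0, and the quotient is 0 by the convention
   x / 0 = 0. *)
Definition density (R : realType) (G : graph) : R :=
  #|edges G|%:R / 'C(#|G|, 2)%:R.

Definition shattered (X : finType) (F : {set {set X}}) (S : {set X}) : bool :=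
  [forall B : {set X}, (B \subset S) ==> [exists A in F, A :&: S == B]].

(* The maximum is 0 for the empty set system, which shatters no set at all. *)
Definition vc_dim (X : finType) (F : {set {set X}}) : nat :=
  \max_(S : {set X} | shattered F S) #|S|.

Definition graph_vc_dim (G : graph) : nat :=
  vc_dim [set neighbours v | v : G].

(* Containment as a not necessarily induced subgraph. *)
Definition contains (G H : graph) : Prop :=
  exists2 h : H -> G, injective h & forall x y : H, adj x y -> adj (h x) (h y).

Definition bip_adj (t : nat) : rel ('I_t + 'I_t)%type :=
  fun x y => match x, y with
             | inl _, inr _ | inr _, inl _ => true
             | _, _ => false
             end.

Lemma bip_adj_sym (t : nat) : symmetric (@bip_adj t).
Proof. by case=> i [] j. Qed.

Lemma bip_adj_irr (t : nat) : irreflexive (@bip_adj t).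
Proof. by case. Qed.

Definition complete_bipartite (t : nat) : graph :=
  Graph (@bip_adj_sym t) (@bip_adj_irr t).

(* A function from R^+ to R^+ is a function on R that is positive at positive
   arguments; its other values are never used.  Num.truncn is the integer part,
   as a natural number, of a nonnegative real. *)
Definition B2_property (R : realType) (C : graph -> Prop) : Prop :=
  exists f : R -> R,
    (forall e : R, 0 < e -> 0 < f e) /\
    forall (e : R) (G : graph), 0 < e -> C G -> e < density R G ->
      contains G (complete_bipartite (Num.truncn (f e * #|G|%:R))).

(* Main.v *)
Require Import Defs.
From mathcomp Require Import all_boot all_order all_algebra.
From mathcomp Require Import reals.
From mathcomp Require Import ring lra zify.

Set Implicit Arguments.
Unset Strict Implicit.
Unset Printing Implicit Defensive.

Import Order.TTheory GRing.Theory Num.Theory.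
Local Open Scope ring_scope.

(* If no pair of vertices is shattered, any two neighbourhoods are disjoint,
   nested, or cover all vertices.  Among the linearly many vertices of linear
   degree, fix one vertex r.  If half of them are not adjacent to r, their
   neighbourhoods are laminar; by averaging some vertex lies in linearly many of
   them, which then form a chain, and the smallest member of the chain is one
   side of a biclique.  Otherwise half of them are adjacent to r, the
   complements of the neighbourhoods are laminar, and non-adjacency is an
   equivalence relation on this half: a large class yields a chain as before,
   and if all classes are small, splitting them into two balanced groups yields
   a biclique.

   For d >= 2, take the complement of the polarity graph y + y' = x x' on the
   affine plane over F_p.  The polarity graph has no 4-cycle, which bounds the
   VC-dimension of the complement by 2, and a second moment computation shows
   that sets A, B without incidences satisfy |A| |B| <= p^3, which is o(n^2).
   Joining it completely to a fixed graph raises the VC-dimension to exactly d. *)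

(** * Bicliques as vertex sets *)

Definition biclique (G : graph) (A B : {set G}) : Prop :=
  forall a b, a \in A -> b \in B -> adj a b.

Lemma biclique_contains (G : graph) (A B : {set G}) (t : nat) :
  biclique A B -> (t <= #|A|)%N -> (t <= #|B|)%N ->
  contains G (complete_bipartite t).
Proof.
move=> AB tA tB.
pose hA (i : 'I_t) := enum_val (widen_ord tA i).
pose hB (i : 'I_t) := enum_val (widen_ord tB i).
have hAB i j : adj (hA i) (hB j) by apply: AB; apply: enum_valP.
have wI n (le_tn : (t <= n)%N) : injective (widen_ord le_tn).
  by move=> i j /(congr1 val) ij; apply: val_inj.
pose h (x : complete_bipartite t) : G :=
  match x with inl i => hA i | inr j => hB j end.
exists h; last by case=> i [] j //= _; rewrite ?hAB // adj_sym.
case=> i [] j /= hij.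
- by congr (inl _); apply: (wI _ tA); apply: enum_val_inj hij.
- by have := hAB i j; rewrite hij adj_irr.
- by have := hAB j i; rewrite hij adj_irr.
- by congr (inr _); apply: (wI _ tB); apply: enum_val_inj hij.
Qed.

Lemma contains_biclique (G : graph) (t : nat) :
  contains G (complete_bipartite t) ->
  exists A B : {set G}, [/\ biclique A B, #|A| = t & #|B| = t].
Proof.
case=> h hI hE.
exists [set h (inl i) | i : 'I_t], [set h (inr i) | i : 'I_t]; split.
- by move=> _ _ /imsetP[i _ ->] /imsetP[j _ ->]; apply: hE.
- by rewrite card_imset ?card_ord // => i j /hI [].
- by rewrite card_imset ?card_ord // => i j /hI [].
Qed.

(** * VC-dimension one and cross-free neighbourhoods *)

Definition crossfree (G : graph) : Prop :=
  forall a b : G,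
    [\/ neighbours a \subset neighbours b, neighbours b \subset neighbours a,
        [disjoint neighbours a & neighbours b]
      | neighbours a :|: neighbours b = setT].

Lemma leq_vc_dim (X : finType) (F : {set {set X}}) (S : {set X}) :
  shattered F S -> (#|S| <= vc_dim F)%N.
Proof.
by move=> shS; rewrite /vc_dim; apply: (@leq_bigmax_cond _ _ (fun S : {set X} => #|S|)).
Qed.

Lemma vc_dim_leq (X : finType) (F : {set {set X}}) (k : nat) :
  (forall S, shattered F S -> (#|S| <= k)%N) -> (vc_dim F <= k)%N.
Proof. by move=> le_k; apply/bigmax_leqP. Qed.

Lemma shatteredP (G : graph) (S : {set G}) :
  reflect (forall B : {set G}, B \subset S ->
             exists v : G, neighbours v :&: S = B)
          (shattered [set neighbours v | v : G] S).
Proof.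
apply: (iffP forallP) => [shS B BS | shS B].
  have /implyP/(_ BS)/existsP[_ /andP[/imsetP[v _ ->] /eqP <-]] := shS B.
  by exists v.
apply/implyP=> /shS[v <-]; apply/existsP; exists (neighbours v).
by rewrite eqxx andbT imset_f.
Qed.

(** If all four alternatives fail, their witnesses [v], [w], [u], [z] leave the traces [{a}], [{b}],
    [{a, b}] and the empty one on [{a, b}]. *)
Lemma vc_dim1_crossfree (G : graph) : (graph_vc_dim G <= 1)%N -> crossfree G.
Proof.
move=> vcG a b.
case: (boolP (neighbours a \subset neighbours b)) => [|/subsetPn[v av bv]].
  by constructor 1.
case: (boolP (neighbours b \subset neighbours a)) => [|/subsetPn[w bw aw]].
  by constructor 2.
case: (boolP [disjoint neighbours a & neighbours b]) => [|/pred0Pn[u /andP[]]].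
  by constructor 3.
rewrite /= => au bu.
case: (eqVneq (neighbours a :|: neighbours b) setT) => [|]; first by constructor 4.
rewrite -subTset => /subsetPn[z _].
move: av bv bw aw au bu; rewrite !inE negb_or => av bv bw aw au bu /andP[az bz].
have ab : a != b by apply: contraNneq bv => <-.
suff shS : shattered [set neighbours v | v : G] [set a; b].
  by have := leq_trans (leq_vc_dim shS) vcG; rewrite cards2 ab.
apply/shatteredP=> B /subsetP BS.
have BE x : x \in B = (x == a) && (a \in B) || (x == b) && (b \in B).
  have [->|xa] := eqVneq x a; first by rewrite (negPf ab) orbF.
  have [->|xb] := eqVneq x b; first by [].
  by apply: contraNF xa => /BS; rewrite !inE (negPf xb) orbF.
have trace y : adj a y = (a \in B) -> adj b y = (b \in B) ->
    neighbours y :&: [set a; b] = B.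
  move=> ay bY; apply/setP=> x; rewrite BE !inE andb_orr.
  by congr orb; case: eqP => [->|]; rewrite ?andbF ?andbT //= adj_sym.
case aB: (a \in B); case bB: (b \in B).
- by exists u; apply: trace; rewrite ?au ?bu.
- by exists v; apply: trace; rewrite ?av ?(negPf bv).
- by exists w; apply: trace; rewrite ?bw ?(negPf aw).
- by exists z; apply: trace; rewrite ?(negPf az) ?(negPf bz).
Qed.

(** * Bicliques in cross-free graphs *)

Lemma chain_biclique (G : graph) (C : {set G}) (k : nat) :
  C != set0 -> {in C, forall x, (k <= #|neighbours x|)%N} ->
  {in C &, forall x y, neighbours x \subset neighbours y
                       \/ neighbours y \subset neighbours x} ->
  exists2 B : {set G}, biclique C B & (k <= #|B|)%N.
Proof.
case/set0Pn=> c cC degC chC.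
case: (@arg_minnP _ c (mem C) (fun x => #|neighbours x|) cC) => x xC xmin.
exists (neighbours x); last exact: degC.
move=> a b aC bx.
suff /subsetP/(_ b bx) : neighbours x \subset neighbours a by rewrite inE.
have [//|ax] := chC x a xC aC.
suff /eqP-> : neighbours a == neighbours x by [].
by rewrite eqEcard ax xmin.
Qed.

Lemma card_adj_sum (G : graph) (H : {set G}) :
  (\sum_(x in H) #|neighbours x| = \sum_v #|neighbours v :&: H|)%N.
Proof.
under eq_bigr => x _ do rewrite -sum1_card.
under [RHS]eq_bigr => x _ do rewrite -sum1_card.
rewrite (exchange_big_dep predT) //=; apply: eq_bigr => v _.
by apply: eq_bigl => x; rewrite !inE andbC adj_sym.
Qed.

Lemma crossfree_biclique (G : graph) (H : {set G}) (k t : nat) :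
  crossfree G -> {in H, forall x, (k <= #|neighbours x|)%N} ->
  (t <= k)%N -> (8 * t <= #|H|)%N -> (2 * (t * #|G|) <= #|H| * k)%N ->
  exists A B : {set G}, [/\ biclique A B, (t <= #|A|)%N & (t <= #|B|)%N].
Proof.
move=> cfG degH tk tH tHk.
have [->|t_gt0] := posnP t.
  by exists set0, set0; split=> // a b; rewrite inE.
have [r rH] : exists r, r \in H by apply/card_gt0P; lia.
have := cardsID (neighbours r) H.
set H2 := H :&: _; set H1 := H :\: _ => cardH.
have H1H : {subset H1 <= H} by move=> x /setDP[].
have H2H : {subset H2 <= H} by move=> x /setIP[].
have from_chain (C : {set G}) : C \subset H -> (t <= #|C|)%N ->
    {in C &, forall x y, neighbours x \subset neighbours y
                       \/ neighbours y \subset neighbours x} ->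
    exists A B : {set G}, [/\ biclique A B, (t <= #|A|)%N & (t <= #|B|)%N].
  move=> CH tC chC.
  have [||B CB kB] := @chain_biclique G C k _ _ chC.
  - by rewrite -card_gt0; lia.
  - by move=> x /(subsetP CH) /degH.
  by exists C, B; split=> //; lia.
have [H12|H21] := leqP #|H2| #|H1|.
  (* No N(x) with x in H1 contains r, so these sets form a laminar family. *)
  have [/existsP[v tv]|] := boolP [exists v, t <= #|neighbours v :&: H1|]%N.
    apply: (from_chain _ _ tv) => [|x y]; first by apply/subsetP=> x /setIP[_ /H1H].
    rewrite !inE => /and3P[vx rx _] /and3P[vy ry _].
    have [xy|yx|/disjoint_setI0|xUy] := cfG x y; [by left|by right| |].
      by move=> /setP/(_ v); rewrite !inE ![adj _ v]adj_sym vx vy.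
    by have := in_setT r; rewrite -xUy !inE ![adj _ r]adj_sym (negPf rx) (negPf ry).
  (* Averaging: otherwise [2 * t * #|G| <= #|H| * k <= 2 * #|H1| * k <= 2 * #|G| * (t - 1)]. *)
  rewrite negb_exists => /forallP noV; exfalso.
  have G_gt0 : (0 < #|G|)%N by apply/card_gt0P; exists r.
  have le1 : (#|H1| * k <= \sum_(x in H1) #|neighbours x|)%N.
    by rewrite -sum_nat_const; apply: leq_sum => x /H1H /degH.
  have le2 : (\sum_v #|neighbours v :&: H1| <= #|G| * t.-1)%N.
    rewrite -sum_nat_const; apply: leq_sum => v _.
    by have := noV v; rewrite -ltnNge; lia.
  rewrite card_adj_sum in le1.
  have : (#|H| * k <= 2 * #|H1| * k)%N by rewrite leq_mul2r; lia.
  nia.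
(* All N(x) with x in H2 contain r, so the complements of these sets, which
   contain x itself, form a laminar family: being non-adjacent is an
   equivalence relation on H2. *)
pose cl x := H2 :\: neighbours x.
have trans x y z : x \in H2 -> y \in H2 -> z \in H2 ->
    ~~ adj x y -> ~~ adj y z -> ~~ adj x z.
  rewrite !inE => /andP[xH xr] /andP[yH yr] /andP[zH zr] xy yz.
  (* If the sets are nested, adjacency of [x] and [z] would put one of them into its own
     neighbourhood; [r] excludes disjointness, and [y] lies outside the union. *)
  have [xz|zx|/disjoint_setI0 /setP/(_ r)|xUz] := cfG x z.
  - have := subsetP xz z; rewrite !inE adj_irr => zxz.
    by apply/negP=> /zxz.
  - have := subsetP zx x; rewrite !inE adj_irr adj_sym => zxz.
    by apply/negP=> /zxz.
  - by rewrite !inE ![adj _ r]adj_sym xr zr.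
  - by have := in_setT y; rewrite -xUz !inE (negPf xy) adj_sym (negPf yz).
have [/existsP[x /andP[xH2 tx]]|] :=
    boolP [exists x, (x \in H2) && (t <= #|cl x|)%N].
  apply: (from_chain _ _ tx) => [|y z]; first by apply/subsetP=> y /setDP[/H2H].
  move=> /setDP[yH2]; rewrite inE => xy /setDP[zH2]; rewrite inE => xz.
  have yz : ~~ adj y z by apply: (trans _ x); rewrite // adj_sym.
  have [yz'|zy'|/disjoint_setI0 /setP/(_ r)|yUz] := cfG y z; [by left|by right| |].
    by move: yH2 zH2; rewrite !inE ![adj _ r]adj_sym => /andP[_ ->] /andP[_ ->].
  by have := in_setT y; rewrite -yUz !inE adj_irr adj_sym (negPf yz).
rewrite negb_exists => /forallP small.
(* [P] describes unions of classes with at most [2 * t] elements. A largest one has at least [t]: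
   otherwise another class, having fewer than [t] elements, could be added. *)
pose P (A : {set G}) := [&& A \subset H2, (#|A| <= 2 * t)%N &
  [forall x in A, cl x \subset A]].
have P0 : P set0 by rewrite /P sub0set cards0 /=; apply/forall_inP=> x; rewrite inE.
case: (@arg_maxnP _ set0 P (fun A : {set G} => #|A|) P0) => A.
case/and3P=> AH2 At /forall_inP clA Amax.
exists A, (H2 :\: A); split; last by rewrite cardsDS //; lia.
  move=> a b aA /setDP[bH2]; apply: contraR => ab.
  by apply: (subsetP (clA a aA)); apply/setDP; split; last rewrite inE.
rewrite leqNgt; apply/negP=> A_lt_t.
have [x] : exists x, x \in H2 :\: A by apply/card_gt0P; rewrite cardsDS //; lia.
case/setDP=> xH2 xA.
have xcl : x \in cl x by rewrite 2!inE adj_irr.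
have /Amax : P (A :|: cl x).
  apply/and3P; split.
  - by rewrite subUset AH2 subsetDl.
  - have := small x; rewrite xH2 /= -ltnNge.
    by have := (leq_card_setU A (cl x)).1; lia.
  - apply/forall_inP=> y /setUP[/clA yA|]; first by apply: subset_trans yA (subsetUl _ _).
    case/setDP=> yH2; rewrite inE => xy; apply/subsetP=> z /setDP[zH2].
    by rewrite inE => yz; rewrite 3!inE (trans x y z) // zH2 orbT.
apply/negP; rewrite -ltnNge; apply: proper_card; apply/properP.
by split; [exact: subsetUl | exists x; rewrite // inE xcl orbT].
Qed.

(** * From density to many vertices of large degree *)

Lemma card_edges_le (G : graph) :
  (#|edges G| <= \sum_(x : G) #|neighbours x|)%N.
Proof.
apply: leq_trans (leq_imset_card _ _) _.
rewrite -sum1_card; under [X in (_ <= X)%N]eq_bigr => x _ do rewrite -sum1_card.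
rewrite pair_big_dep /=; apply: eq_leq; apply: eq_bigl => -[x y].
by rewrite !inE.
Qed.

Lemma natr_bin2 (R : realType) (n : nat) :
  'C(n, 2)%:R * 2 = n%:R * (n%:R - 1) :> R.
Proof.
case: n => [|n]; first by rewrite !mul0r.
by rewrite mulrC -natrM -mul_bin_diag bin1 natrM -natr1 addrK.
Qed.

Lemma crossfree_B2 (R : realType) (G : graph) (e : R) :
  crossfree G -> 0 < e -> e < density R G ->
  contains G (complete_bipartite (Num.truncn (e ^+ 2 / 512 * #|G|%:R))).
Proof.
move=> cfG e0; rewrite /density => eG.
set n := #|G| in eG *.
(* A zero denominator would make the density 0, which is below [e]. *)
have C0 : (0 < 'C(n, 2))%N.
  rewrite lt0n; apply: contraTneq eG => ->.
  by rewrite invr0 mulr0 -leNgt ltW.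
have n2 : (2 <= n)%N by rewrite -bin_gt0.
have nR : 2 <= n%:R :> R by rewrite (ler_nat _ 2).
have eE : e * 'C(n, 2)%:R < #|edges G|%:R by rewrite -ltr_pdivlMr ?ltr0n.
have CE := natr_bin2 R n.
(* The degree threshold is [d * n], and [e ^+ 2 / 512] is [d ^+ 2 / 8]. There are more than
   [4 * d * n * (n - 1) >= 2 * d * n ^ 2] edges; vertices outside [H] account for at most
   [d * n ^ 2], so [H] has at least [d * n] elements. *)
set d := e / 8.
have d0 : 0 < d by rewrite divr_gt0.
have dn0 : 0 <= d * n%:R by rewrite mulr_ge0 // ltW.
set k := (Num.truncn (d * n%:R)).+1.
have kE : d * n%:R < k%:R by apply: truncnS_gt.
pose H := [set x : G | (k <= #|neighbours x|)%N].
have degN x : x \notin H -> #|neighbours x|%:R <= d * n%:R.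
  by rewrite inE -ltnNge ltnS truncn_ge_nat.
have HE : d * n%:R <= #|H|%:R.
  have : (#|edges G|%:R : R) <= #|H|%:R * n%:R + n%:R * (d * n%:R).
    apply: le_trans (_ : \sum_(x : G) (#|neighbours x|%:R : R) <= _).
      by rewrite -natr_sum ler_nat card_edges_le.
    rewrite (bigID (mem H)) /=; apply: lerD.
      rewrite mulr_natl -sumr_const; apply: ler_sum => x _.
      by rewrite ler_nat max_card.
    apply: le_trans (_ : \sum_(x | x \notin H) d * n%:R <= _).
      exact: ler_sum.
    rewrite sumr_const -[leLHS]mulr_natl ler_wpM2r ?ler_nat ?max_card //.
  have n0 : 0 < n%:R :> R by lra.
  move=> edgesH; rewrite -(ler_pM2r n0).
  have eE8 : e = d * 8 by rewrite /d; field.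
  rewrite eE8 in eE; nra.
have H0 : (0 < #|H|)%N.
  by rewrite -(ltr0n R); apply: lt_le_trans HE; apply: mulr_gt0 => //; lra.
have d1 : d <= 1.
  have [x] := card_gt0P H0; rewrite inE => kx.
  have : d * n%:R < n%:R.
    by apply: lt_le_trans kE _; rewrite ler_nat; apply: leq_trans kx (max_card _).
  nra.
set t := Num.truncn _.
have tE : t%:R <= d ^+ 2 / 8 * n%:R.
  have -> : d ^+ 2 / 8 = e ^+ 2 / 512 by rewrite /d; field.
  have : 0 <= e ^+ 2 / 512 * n%:R by rewrite mulr_ge0 // divr_ge0 // sqr_ge0.
  by case/truncn_itv/andP.
have tE' : t%:R <= d / 8 * n%:R.
  apply: le_trans tE _; rewrite ler_wpM2r ?ler0n // ler_wpM2r ?invr_ge0 //.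
  by rewrite expr2 ler_piMr // ltW.
have [||||A [B [AB tA tB]]] := @crossfree_biclique G H k t cfG.
- by move=> x; rewrite inE.
- by rewrite -(ler_nat R); nra.
- by rewrite -(ler_nat R) natrM; nra.
- rewrite -(ler_nat R) !natrM -/n.
  apply: le_trans (_ : (d * n%:R) * (d * n%:R) <= _).
    have : t%:R * n%:R <= d ^+ 2 / 8 * n%:R * n%:R :> R by rewrite ler_wpM2r.
    by have := sqr_ge0 (d * n%:R); rewrite expr2; lra.
  by apply: ler_pM => //; exact: ltW.
exact: biclique_contains AB tA tB.
Qed.

(** * The polarity graph and its complement *)

(* In the complement of a C4-free graph, no set of three vertices has both the
   empty trace (that of v) and all the singletons (those of a, b, c). *)
Lemma C4free_trace3 (T : eqType) (r : rel T) (x y z v a b c : T) :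
  symmetric r ->
  (forall u u' w w', r u w -> r u' w -> r u w' -> r u' w' -> u = u' \/ w = w') ->
  x != y -> y != z -> z != x ->
  let c1 := [rel u w | (u == w) || r u w] in
  [&& c1 v x, c1 v y & c1 v z] ->
  [&& ~~ c1 a x, c1 a y & c1 a z] ->
  [&& c1 b x, ~~ c1 b y & c1 b z] ->
  [&& c1 c x, c1 c y & ~~ c1 c z] -> False.
Proof.
move=> rS C4 + + + c1.
(* Both [v] and [c'] are equal or related to [x'] and to [y']. If [v] is neither of these,
   C4-freeness makes [c'] one of them, whence [r x' y']. *)
have main x' y' z' c' : x' != y' -> y' != z' -> z' != x' ->
   [&& c1 v x', c1 v y' & c1 v z'] -> [&& c1 c' x', c1 c' y' & ~~ c1 c' z'] ->
   v != z' /\ (v != x' -> v != y' -> r x' y').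
  rewrite /c1 /= => xy yz zx /and3P[vx vy vz] /and3P[cx cy].
  rewrite negb_or => /andP[cz rcz].
  have vc : v != c' by apply: contraTneq vz => ->; rewrite negb_or cz.
  split.
    apply/eqP=> E; subst v.
    move: vx vy; rewrite (negPf zx) eq_sym (negPf yz) /= => zx' zy'.
    case/orP: cx => [/eqP E|cx]; first by move: rcz; rewrite E rS zx'.
    case/orP: cy => [/eqP E|cy]; first by move: rcz; rewrite E rS zy'.
    by case: (C4 z' c' x' y') => // /eqP; [rewrite (negPf vc)|rewrite (negPf xy)].
  move=> nvx nvy; move: vx vy; rewrite (negPf nvx) (negPf nvy) /= => vx vy.
  case/orP: cx => [/eqP E|cx].
    by case/orP: cy => [/eqP E'|]; [rewrite -E -E' eqxx in xy|rewrite E].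
  case/orP: cy => [/eqP E|cy]; first by rewrite rS -E.
  by case: (C4 v c' x' y') => // /eqP; [rewrite (negPf vc)|rewrite (negPf xy)].
move=> xy yz zx hv ha hb hc.
case/and3P: (hv) => hvx hvy hvz; case/and3P: ha => ax ay az.
case/and3P: hb => bx b_y bz.
(* Rotating the roles makes [v, x, y, z] four distinct, pairwise related elements, which contain a
   4-cycle. *)
have [vz rxy] := main x y z c xy yz zx hv hc.
have [||vx ryz] := main y z x a yz zx xy; [by apply/and3P | by apply/and3P |].
have [||vy rzx] := main z x y b zx xy yz; [by apply/and3P | by apply/and3P |].
have {}rxy := rxy vx vy; have {}ryz := ryz vy vz; have {}rzx := rzx vz vx.
case/and3P: hv; rewrite /c1 /= (negPf vx) (negPf vy) (negPf vz) /= => rvx rvy rvz.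
by case: (C4 v z x y) => //; [rewrite rS | move/eqP; rewrite (negPf vz) | move/eqP; rewrite (negPf xy)].
Qed.

(* Points (x, y) and lines Y = m X - b of an affine plane, both named by pairs;
   the relation is symmetric. *)
Definition inc (F : finFieldType) : rel (F * F) :=
  fun u v => u.2 + v.2 == u.1 * v.1.

Lemma inc_sym (F : finFieldType) : symmetric (@inc F).
Proof. by move=> u v; rewrite /inc addrC mulrC. Qed.

Lemma inc_C4free (F : finFieldType) (u u' v v' : F * F) :
  inc u v -> inc u' v -> inc u v' -> inc u' v' -> u = u' \/ v = v'.
Proof.
case: u u' v v' => [x y] [x' y'] [m b] [m' b']; rewrite /inc /=.
move=> /eqP e1 /eqP e2 /eqP e3 /eqP e4.
have [E|xx'] := eqVneq x x'.
  by left; subst x'; congr pair; apply: (@addIr _ b); rewrite e1 e2.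
right; have E : m = m'.
  have : (x - x') * (m - m') = 0.
    have -> : (x - x') * (m - m') = (x * m - x' * m) - (x * m' - x' * m') by ring.
    rewrite -e1 -e2 -e3 -e4; ring.
  by move/eqP; rewrite mulf_eq0 !subr_eq0 (negPf xx') => /eqP.
by rewrite E; congr pair; apply: (@addrI _ y); rewrite e1 e3 E.
Qed.

Lemma card_inc (F : finFieldType) (u : F * F) : #|[set v | inc u v]| = #|F|.
Proof.
rewrite -[RHS]cardsT -(@card_imset _ _ (fun m => (m, u.1 * m - u.2))); last by move=> m m' [].
apply: eq_card => -[m b]; rewrite !inE /inc /=.
apply/eqP/imsetP => [E|[m' _ [-> ->]]]; last by ring.
by exists m => //; rewrite -E; congr pair; ring.
Qed.

(* Chebyshev: for v uniform, the number of u in A incident to v has mean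
   |A| / q and, as two points lie on at most one line, variance at most |A| / q. *)
Lemma nonincident_card (F : finFieldType) (A B : {set F * F}) :
  {in A & B, forall u v, ~~ inc u v} -> (#|A| * #|B| <= #|F| ^ 3)%N.
Proof.
move=> AB; set q := #|F|.
pose d (v : F * F) : nat := (\sum_(u in A) inc u v)%N.
have sum_inc (u : F * F) : (\sum_v inc u v = q)%N.
  apply: etrans (card_inc u); rewrite -sum1dep_card [RHS]big_mkcond.
  by apply: eq_bigr => v _; case: (inc u v).
have sum_d : (\sum_v d v = #|A| * q)%N.
  by rewrite exchange_big /= -sum_nat_const; apply: eq_bigr.
have sum_d2 : (\sum_v d v ^ 2 <= #|A| * q + #|A| ^ 2)%N.
  have -> : (\sum_v d v ^ 2 = \sum_(u in A) \sum_(u' in A) \sum_v inc u v * inc u' v)%N.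
    under [RHS]eq_bigr => u _ do rewrite exchange_big /=.
    rewrite exchange_big; apply: eq_bigr => v _ /=.
    rewrite -mulnn big_distrl /=; apply: eq_bigr => u _.
    by rewrite big_distrr.
  have -> : (#|A| * q + #|A| ^ 2 = \sum_(u in A) (q + \sum_(u' in A) 1))%N.
    by rewrite sum1_card sum_nat_const; lia.
  (* The term [u' = u] contributes [q], every other [u'] at most 1. *)
  apply: leq_sum => u uA; rewrite [leqLHS](bigD1 u) //=; apply: leq_add.
    by rewrite -(sum_inc u); apply: leq_sum => v _; case: (inc u v).
  rewrite [leqRHS](bigD1 u) //=; apply: leq_trans (leq_addl _ _).
  apply: leq_sum => u' /andP[_ uu'].
  have -> : (\sum_v inc u v * inc u' v = #|[set v | inc u v && inc u' v]|)%N.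
    rewrite -sum1dep_card [RHS]big_mkcond; apply: eq_bigr => v _.
    by case: (inc u v); case: (inc u' v).
  apply/card_le1_eqP=> v w; rewrite !inE => /andP[uv u'v] /andP[uw u'w].
  by case: (inc_C4free uv u'v uw u'w) => // E; rewrite E eqxx in uu'.
have dB v : v \in B -> d v = 0%N.
  by move=> vB; apply: big1 => u uA; rewrite (negPf (AB u v uA vB)).
have [->|A0] := posnP #|A|; first by [].
have cardFF : #|{: F * F}| = (q * q)%N by rewrite card_prod.
(* Scaling by [q] keeps the deviations integral. Each [v] in [B] contributes [#|A| ^ 2] to this
   sum. *)
have : (\sum_v ((q%:R * (d v)%:R - #|A|%:R) ^+ 2 : int)) <= (#|A| * q ^ 3)%:R.
  under eq_bigr => v _ do rewrite sqrrB.
  rewrite big_split sumrB /= sumr_const cardFF.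
  have -> : \sum_v (q%:R * (d v)%:R) ^+ 2 = (q ^ 2 * \sum_v d v ^ 2)%:R :> int.
    rewrite natrM natr_sum big_distrr; apply: eq_bigr => v _.
    by rewrite exprMn !natrX.
  have -> : \sum_v q%:R * (d v)%:R * #|A|%:R *+ 2 = (2 * q * #|A| * (#|A| * q))%:R :> int.
    rewrite -sum_d natrM natr_sum big_distrr; apply: eq_bigr => v _ /=.
    by rewrite !natrM -mulr_natl; ring.
  have := sum_d2; rewrite -(ler_nat int) natrD !natrM ?natrX.
  move/(ler_wpM2l (sqr_ge0 (q%:R : int))).
  by rewrite -[_ ^+ 2 *+ _]mulr_natr !natrM; lra.
have : (#|A| ^ 2 * #|B|)%:R <= \sum_v ((q%:R * (d v)%:R - #|A|%:R) ^+ 2 : int).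
  rewrite (bigID (mem B)) /= -[leLHS]addr0; apply: lerD; last first.
    by apply: sumr_ge0 => v _; apply: sqr_ge0.
  under eq_bigr => v vB do rewrite (dB v vB) mulr0 sub0r sqrrN.
  by rewrite sumr_const -[leRHS]mulr_natr natrM natrX.
move=> h1 h2; have := le_trans h1 h2; rewrite ler_nat.
by rewrite -mulnn -mulnA leq_pmul2l.
Qed.

(** * The joined graph and its VC-dimension *)

Lemma card_ord_sets (d : nat) : #|{: 'I_d + {set 'I_d}}| = (d + 2 ^ d)%N.
Proof.
by rewrite card_sum card_ord -[#|{set _}|]cardsT -powersetT card_powerset cardsT card_ord.
Qed.

Section Witness.
Variables (F : finFieldType) (d : nat).

(* The complete join leaves the trace of a vertex of one part on the other part
   full, so it adds no empty trace: with one added, the plane alone would have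
   VC-dimension 3. *)
Definition witness_adj : rel (F * F + ('I_d + {set 'I_d}))%type :=
  fun x y => match x, y with
             | inl u, inl v => (u != v) && ~~ inc u v
             | inl _, inr _ | inr _, inl _ => true
             | inr (inl i), inr (inr A) | inr (inr A), inr (inl i) => i \in A
             | inr _, inr _ => false
             end.

Lemma witness_adj_sym : symmetric witness_adj.
Proof. by move=> [u|[i|A]] [v|[j|B]] //=; rewrite eq_sym inc_sym. Qed.

Lemma witness_adj_irr : irreflexive witness_adj.
Proof. by move=> [u|[i|A]] //=; rewrite eqxx. Qed.

Definition witness : graph := Graph witness_adj_sym witness_adj_irr.

Lemma card_witness : #|witness| = (#|F| ^ 2 + (d + 2 ^ d))%N.
Proof. by rewrite card_sum card_ord_sets card_prod mulnn. Qed.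

Lemma witness_vc_ge : (d <= graph_vc_dim witness)%N.
Proof.
pose S : {set witness} := [set inr (inl i) | i : 'I_d].
have <- : #|S| = d by rewrite card_imset ?card_ord // => i j [].
apply: leq_vc_dim; apply/shatteredP=> B /subsetP BS.
exists (inr (inr [set i | inr (inl i) \in B]) : witness).
apply/setP=> x; rewrite !inE; apply/andP/idP => [[xB /imsetP[i _ E]]|xB].
  by move: xB; rewrite E /= inE.
have xS := BS x xB; split=> //; case/imsetP: xS xB => i _ -> iB.
by rewrite /= inE.
Qed.

(** A vertex with empty trace is adjacent to nothing in [S]; since the join is complete, [S] lies in
    the same part as that vertex. *)
Lemma witness_vc_le : (2 <= d)%N -> (graph_vc_dim witness <= d)%N.
Proof.
move=> d2; apply: vc_dim_leq => S /shatteredP shS.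
have trace (B : {set witness}) : B \subset S ->
    exists v : witness, {in S, forall x, adj v x = (x \in B)}.
  by move=> /shS[v <-]; exists v => x xS; rewrite !inE xS andbT.
have [v0 v0S] := trace set0 (sub0set S).
case: v0 v0S => [v|q] v0S.
  (* The trace [set0] forces S into the affine plane, where it has at most two
     elements because the polarity graph contains no 4-cycle. *)
  apply: leq_trans d2; rewrite leqNgt; apply/negP=> /card_gt2P[x0 [y0 [z0 []]]].
  case=> xS yS zS [].
  have adjE u w : @adj witness (inl u) (inl w) = (u != w) && ~~ inc u w by [].
  have inK (a : witness) : a \in S -> exists2 u, a = inl u & (v == u) || inc v u.
    move=> /v0S; rewrite inE; case: a => [u|q]; [rewrite adjE => /negbT|by []].
    by rewrite -negb_or negbK; exists u.
  have [[x Ex vx] [y Ey vy] [z Ez vz]] := And3 (inK _ xS) (inK _ yS) (inK _ zS).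
  subst x0 y0 z0 => xy yz zx.
  pose c1 := [rel u w : F * F | (u == w) || inc u w].
  have single (a b c : F * F) : inl a \in S -> inl b \in S -> inl c \in S ->
      a != b -> a != c -> exists w, [&& ~~ c1 w a, c1 w b & c1 w c].
    move=> aS bS cS ab ac.
    have [|w wS] := trace [set (inl a : witness)]; first by rewrite sub1set.
    have wa : adj w (inl a) by rewrite wS // set11.
    have wb : adj w (inl b) = false by rewrite wS // inE; apply: contraNF ab => /eqP[->].
    have wc : adj w (inl c) = false by rewrite wS // inE; apply: contraNF ac => /eqP[->].
    case: w wa wb wc {wS} => [w|[i|C]]; [rewrite !adjE|by []|by []].
    move=> wa /negbT wb /negbT wc; exists w.
    by rewrite /= negb_or wa; move: wb wc; rewrite -!negb_or !negbK => -> ->.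
  have {}xy : x != y by apply: contraNneq xy => ->.
  have {}yz : y != z by apply: contraNneq yz => ->.
  have {}zx : z != x by apply: contraNneq zx => ->.
  have [||a ha] := single x y z xS yS zS; rewrite // 1?eq_sym //.
  have [||b hb] := single y x z yS xS zS; rewrite // 1?eq_sym //.
  have [||c hc] := single z x y zS xS yS; rewrite // 1?eq_sym //.
  apply: (@C4free_trace3 _ (@inc F) x y z v a b c) => //.
  - exact: inc_sym.
  - exact: inc_C4free.
  - by apply/and3P; split.
  - by case/and3P: hb => h1 h2 h3; apply/and3P; split.
  - by case/and3P: hc => h1 h2 h3; apply/and3P; split.
have SQ x : x \in S -> exists q', x = inr q'.
  by move=> /v0S; rewrite inE; case: q v0S x => [i|C] _ [u|q'] //= _; exists q'.
(* All vertices of the plane leave the same trace S, so S has at most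
   1 + d + 2 ^ d traces. *)
have : powerset S \subset
    S |: [set neighbours (inr q' : witness) :&: S | q' : 'I_d + {set 'I_d}].
  apply/subsetP=> B; rewrite inE => /shS[[u|q'] <-]; rewrite !inE; last first.
    by apply/orP; right; apply: imset_f.
  apply/orP; left; rewrite eqEsubset subsetIr subsetI subxx andbT.
  by apply/subsetP=> x /SQ[q' ->]; rewrite inE.
move=> /subset_leq_card; rewrite card_powerset => le1.
have le2 : (2 ^ #|S| <= 1 + (d + 2 ^ d))%N.
  apply: leq_trans le1 _; apply: leq_trans (leq_card_setU _ _).1 _.
  by rewrite cards1 leq_add2l -card_ord_sets leq_imset_card.
rewrite leqNgt; apply/negP=> dS.
have : (2 ^ d.+1 <= 2 ^ #|S|)%N by rewrite leq_exp2l.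
(* This gives [1 + (d + 2 ^ d) < 2 ^ d.+1], so [S] cannot have [d.+1] elements. *)
have : (d + 2 <= 2 ^ d)%N.
  by elim: d d2 => [//|[|[|k]] IH] // _; rewrite expnS; move: (2 ^ k.+2)%N (IH isT); lia.
rewrite expnS; move: (2 ^ d)%N (2 ^ #|S|)%N le2; lia.
Qed.

Lemma witness_biclique (A B : {set witness}) (t : nat) :
  biclique A B -> (t + (d + 2 ^ d) <= #|A|)%N -> (t + (d + 2 ^ d) <= #|B|)%N ->
  (t ^ 2 <= #|F| ^ 3)%N.
Proof.
move=> AB tA tB.
pose K (C : {set witness}) := [set u : F * F | inl u \in C].
have cardK (C : {set witness}) : (#|C| <= #|K C| + (d + 2 ^ d))%N.
  have -> : (d + 2 ^ d)%N = #|[set: 'I_d + {set 'I_d}]|.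
    by rewrite cardsT card_ord_sets.
  rewrite -(card_imset (K C) (@inl_inj _ ('I_d + {set 'I_d})%type)).
  rewrite -(card_imset setT (@inr_inj (F * F)%type _)).
  apply: leq_trans (leq_card_setU _ _).1; apply: subset_leq_card.
  apply/subsetP=> -[u|q] xC; rewrite inE; apply/orP; [left|right]; apply: imset_f => //.
  by rewrite inE.
have KA : (t <= #|K A|)%N by have := cardK A; lia.
have KB : (t <= #|K B|)%N by have := cardK B; lia.
apply: leq_trans (_ : (#|K A| * #|K B| <= _)%N); first by rewrite -mulnn leq_mul.
apply: nonincident_card => u v; rewrite !inE => uA vB.
by have /andP[] := AB _ _ uA vB.
Qed.

End Witness.

(** * Density of the joined graph and failure of the B_2 property *)

(** An ordered pair mapped to the edge [[set x; y]] lies in the square of this set, which has at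
    most 4 elements. *)
Lemma card_edges_ge (G : graph) :
  (\sum_(x : G) #|neighbours x| <= 4 * #|edges G|)%N.
Proof.
under eq_bigr => x _ do rewrite -sum1_card.
rewrite pair_big_dep /=.
rewrite (partition_big (fun p : G * G => [set p.1; p.2]) (mem (edges G))) /=; last first.
  by move=> p; rewrite inE => pE; apply: imset_f; rewrite inE.
rewrite mulnC -sum_nat_const; apply: leq_sum => E /imsetP[[x y] _ ->] /=.
rewrite sum1dep_card.
apply: leq_trans (_ : (#|setX [set x; y] [set x; y]| <= _)%N).
  apply/subset_leq_card/subsetP=> -[a b]; rewrite inE => /andP[_ /eqP abE].
  by rewrite in_setX /= -abE !inE !eqxx orbT.
by rewrite cardsX (@leq_mul _ _ 2 2) // cards2 ltnS; case: eqP.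
Qed.

Lemma witness_degree (F : finFieldType) (d : nat) (u : F * F) :
  (#|F| ^ 2 - #|F|.+1 <= #|neighbours (inl u : witness F d)|)%N.
Proof.
pose D := [set v : F * F | (u != v) && ~~ inc u v].
have DN : [set inl v | v in D] \subset neighbours (inl u : witness F d).
  by apply/subsetP=> _ /imsetP[v vD ->]; rewrite inE in vD; rewrite inE.
apply: leq_trans (subset_leq_card DN); rewrite card_imset; last exact: inl_inj.
have -> : (#|F| ^ 2 = #|{: F * F}|)%N by rewrite card_prod mulnn.
rewrite -(cardC D) leq_subLR addnC leq_add2r -(card_inc u).
have -> : #|[predC D]| = #|u |: [set v | inc u v]|.
  by apply: eq_card => v; rewrite 2!inE -negb_or negbK !inE eq_sym.
by apply: leq_trans (leq_card_setU _ _).1 _; rewrite cards1.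
Qed.

(** There are at least [q ^ 4 / 16] edges and at most [2 * q ^ 2] vertices, so the density is at
    least 1/32. *)
Lemma witness_density (R : realType) (F : finFieldType) (d : nat) :
  (d + 2 ^ d <= #|F| ^ 2)%N -> 40^-1 < density R (witness F d).
Proof.
move=> dq; set q := #|F| in dq *.
have q2 : (2 <= q)%N := card_finNzRing_gt1 F.
set G := witness F d.
have cG : #|G| = (q ^ 2 + (d + 2 ^ d))%N := card_witness F d.
have eG : (q ^ 2 * (q ^ 2 - q.+1) <= 4 * #|edges G|)%N.
  apply: leq_trans (card_edges_ge G); rewrite big_sumType /=.
  apply: leq_trans (leq_addr _ _).
  have -> : (q ^ 2 = #|{: F * F}|)%N by rewrite card_prod mulnn.
  rewrite -sum_nat_const; apply: leq_sum => u _.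
  by rewrite card_prod mulnn witness_degree.
have n2 : (2 <= #|G|)%N by rewrite cG; nia.
rewrite /density ltr_pdivlMr ?ltr0n ?bin_gt0 //.
have nE := natr_bin2 R #|G|.
have nq : #|G|%:R <= 2 * q%:R ^+ 2 :> R by rewrite -natrX -natrM ler_nat cG; lia.
have eR : q%:R ^+ 2 * (q%:R ^+ 2 / 4) <= 4 * #|edges G|%:R :> R.
  have : (q ^ 2 * q ^ 2 <= 4 * (4 * #|edges G|))%N by nia.
  by rewrite -(ler_nat R) !natrM; lra.
have q0 : 2 <= q%:R :> R by rewrite (ler_nat _ 2).
have n0 : 2 <= #|G|%:R :> R by rewrite (ler_nat _ 2).
have nn : #|G|%:R * #|G|%:R <= (2 * q%:R ^+ 2) * (2 * q%:R ^+ 2) :> R.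
  by apply: ler_pM.
have : 0 < q%:R ^+ 2 * q%:R ^+ 2 :> R by do !apply: mulr_gt0; lra.
lra.
Qed.

Lemma not_B2_vc_dim_ge2 (R : realType) (d : nat) :
  (2 <= d)%N -> ~ B2_property R (fun G : graph => graph_vc_dim G = d).
Proof.
move=> d2 [f [f_gt0 fP]].
have e0 : 0 < 40^-1 :> R by rewrite invr_gt0.
set c := f 40^-1; have c0 : 0 < c by apply: f_gt0.
set m := (d + 2 ^ d)%N.
(* The three summands ensure [m <= p], [2 * (1 + m) < p * c] and [4 < p * c ^ 2]. The first gives
   the density bound, the second [c * p ^ 2 / 2 < t - m], and the third contradicts
   [(t - m) ^ 2 <= p ^ 3]. *)
pose M : R := m%:R + 2 * (1 + m%:R) / c + 4 / c ^+ 2.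
have [p pM p_pr] := prime_above (Num.truncn M).
have {}pM : M < p%:R.
  by apply: lt_le_trans (truncnS_gt M) _; rewrite ler_nat.
have m0 : 0 <= m%:R :> R by [].
have a0 : 0 <= 2 * (1 + m%:R) / c by rewrite divr_ge0 ?ltW //; lra.
have b0 : 0 <= 4 / c ^+ 2 by rewrite divr_ge0 ?sqr_ge0.
have pm : (m <= p)%N by rewrite -(ler_nat R); rewrite /M in pM; lra.
have pa : 2 * (1 + m%:R) < p%:R * c.
  by rewrite -ltr_pdivrMr //; rewrite /M in pM; lra.
have pb : 4 < p%:R * c ^+ 2.
  by rewrite -ltr_pdivrMr ?exprn_gt0 //; rewrite /M in pM; lra.
pose F := 'F_p; have cF : #|F| = p by apply: card_Fp.
have p1 := prime_gt1 p_pr.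
have vcG : graph_vc_dim (witness F d) = d.
  by apply/eqP; rewrite eqn_leq witness_vc_le // witness_vc_ge.
have /contains_biclique[A [B [AB]]] := fP _ _ e0 vcG
  (@witness_density R F d ltac:(rewrite cF; nia)).
rewrite card_witness cF -/m -/c; set t := Num.truncn _ => At Bt.
have tE : c * p%:R ^+ 2 < t%:R + 1.
  apply: le_lt_trans (_ : c * (p ^ 2 + m)%:R < _).
    by rewrite ler_pM2l // -natrX ler_nat leq_addr.
  by rewrite natr1 truncnS_gt.
have pR : 1 <= p%:R :> R by rewrite (ler_nat _ 1) ltnW.
have cp : c * p%:R <= c * p%:R ^+ 2.
  by rewrite ler_pM2l // expr2 ler_peMr //; lra.
have mt : (m <= t)%N by rewrite -(ler_nat R); lra.
have : ((t - m) ^ 2 <= #|F| ^ 3)%N.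
  by apply: (witness_biclique AB); rewrite subnK ?At ?Bt.
rewrite cF -(ler_nat R) !natrX natrB //.
have half : c * p%:R ^+ 2 / 2 < t%:R - m%:R by lra.
have : (c * p%:R ^+ 2 / 2) ^+ 2 < (t%:R - m%:R) ^+ 2.
  have ? : 0 <= c * p%:R ^+ 2 / 2 by rewrite divr_ge0 // mulr_ge0 ?sqr_ge0 // ltW.
  by rewrite ltr_pXn2r ?nnegrE //; lra.
have : 4 * p%:R ^+ 3 < p%:R * c ^+ 2 * p%:R ^+ 3.
  by rewrite ltr_pM2r // exprn_gt0 //; lra.
lra.
Qed.

Theorem theorem1p10 (R : realType) (d : nat) (hd : (1 <= d)%N) :
  B2_property R (fun G : graph => graph_vc_dim G = d) <-> d = 1%N.
Proof.
split=> [B2d|->].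
  apply/eqP; rewrite eqn_leq hd andbT leqNgt; apply/negP=> d2.
  exact: not_B2_vc_dim_ge2 d2 B2d.
exists (fun e => e ^+ 2 / 512); split=> [e e0|e G e0 vcG eG].
  by rewrite divr_gt0 ?exprn_gt0.
by apply: crossfree_B2 e0 eG; apply: vc_dim1_crossfree; rewrite vcG.
Qed.
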